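(* The hereditary class property ''transduction of a class with bounded maximum degree'' — the set of hereditary classes $\mathscr C$ for which there exist a class $\mathscr D$ of graphs of bounded maximum degree and a transduction $\mathsf T$ with $\mathscr C\subseteq\mathsf T(\mathscr D)$ — is a decomposition horizon.
   Context: Graphs are finite and simple. For a set $\Sigma$ of unary relation symbols, a $\Sigma$-expansion of a graph adds interpretations of these unary predicates (vertex colors). A simple interpretation $\mathsf I=(\nu(x),\eta(x,y))$ consists of first-order formulas in the language of $\Sigma$-expanded graphs, with $\eta$ symmetric and anti-reflexive; $\mathsf I(G^+)$ is the graph with vertex set $\nu(G^+)$ and edge set $\eta(G^+)\cap\nu(G^+)^2$. A transduction $\mathsf T$ maps a graph $G$ to $\mathsf T(G)=\{\mathsf I(G^+): G^+$ a $\Sigma$-expansion of $G\}$ (no copying of vertices), and $\mathsf T(\mathscr D)=\bigcup_{G\in\mathscr D}\mathsf T(G)$. A hereditary class is a class closed under isomorphism and induced subgraphs; a hereditary class property is a set $\Pi$ of hereditary classes closed under passing to hereditary subclasses. For non-decreasing $f$ and positive integer $p$, $\mathscr C$ has an $f$-bounded $\Pi$-decomposition with parameter $p$ if there is $\mathscr D_p\in\Pi$ such that every $G\in\mathscr C$ has a partition $V_1,\dots,V_N$ of $V(G)$, $N\le f(|G|)$, with $G[V_{i_1}\cup\dots\cup V_{i_p}]\in\mathscr D_p$ for all $i_1,\dots,i_p\in[N]$. $\Pi^\ast$ is the set of hereditary classes that, for every positive integer $p$, have such a decomposition for some non-decreasing $f$ with $f(n)=n^{o(1)}$. $\Pi$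 is a decomposition horizon if $\Pi^\ast=\Pi$. *)

(* Defs.v *)
From mathcomp Require Import all_boot.
Set Implicit Arguments. Unset Strict Implicit. Unset Printing Implicit Defensive.

Record graph := Graph {
  gn : nat;
  gadj : rel 'I_gn;
  gsym : symmetric gadj;
  girr : irreflexive gadj }.

(** A graph class (intended to be closed under isomorphism). *)
Definition gclass := graph -> Prop.

Definition embeds (H G : graph) : Prop :=
  exists f : 'I_(gn H) -> 'I_(gn G),
    injective f /\ forall i j, gadj i j = gadj (f i) (f j).

Definition iso (H G : graph) : Prop :=
  exists f : 'I_(gn H) -> 'I_(gn G),
    bijective f /\ forall i j, gadj i j = gadj (f i) (f j).

Definition hereditary (C : gclass) : Prop :=
  forall G H, C G -> embeds H G -> C H.

Definition induced (G : graph) (X : {set 'I_(gn G)}) : graph :=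
  @Graph #|X| (fun i j => gadj (enum_val i) (enum_val j))
    (fun i j => @gsym G (enum_val i) (enum_val j))
    (fun i => @girr G (enum_val i)).

Definition deg (G : graph) (v : 'I_(gn G)) : nat := #|[set u | gadj v u]|.

Inductive form (k : nat) : Type :=
  | FEdge of nat & nat
  | FEq of nat & nat
  | FCol of 'I_k & nat
  | FNot of form k
  | FAnd of form k & form k
  | FOr of form k & form k
  | FEx of nat & form k
  | FAll of nat & form k.

Fixpoint fv_sub k (P : pred nat) (phi : form k) : bool :=
  match phi with
  | FEdge x y | FEq x y => P x && P y
  | FCol _ x => P x
  | FNot psi => fv_sub P psi
  | FAnd a b | FOr a b => fv_sub P a && fv_sub P b
  | FEx x psi | FAll x psi => fv_sub (fun y => (y == x) || P y) psi
  end.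

Definition upd (V : Type) (a : nat -> V) (x : nat) (v : V) : nat -> V :=
  fun y => if y == x then v else a y.

Fixpoint sat k (G : graph) (col : 'I_(gn G) -> 'I_k -> bool)
  (a : nat -> 'I_(gn G)) (phi : form k) : bool :=
  match phi with
  | FEdge x y => gadj (a x) (a y)
  | FEq x y => a x == a y
  | FCol c x => col (a x) c
  | FNot psi => ~~ sat col a psi
  | FAnd p q => sat col a p && sat col a q
  | FOr p q => sat col a p || sat col a q
  | FEx x psi => [exists v, sat col (upd a x v) psi]
  | FAll x psi => [forall v, sat col (upd a x v) psi]
  end.

Definition asg1 (V : Type) (u : V) : nat -> V := fun _ => u.
Definition asg2 (V : Type) (u v : V) : nat -> V :=
  fun y => if y == 0 then u else v.

(** * Simple interpretations / transductions (no copying) *)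
Record transduction := Transduction {
  tk : nat;
  tnu : form tk;
  teta : form tk;
  tnu_fv : fv_sub (pred1 0) tnu;
  teta_fv : fv_sub (fun y => y < 2) teta;
  teta_sym : forall (G : graph) (col : 'I_(gn G) -> 'I_tk -> bool) u v,
      sat col (asg2 u v) teta = sat col (asg2 v u) teta;
  teta_irr : forall (G : graph) (col : 'I_(gn G) -> 'I_tk -> bool) u,
      ~~ sat col (asg2 u u) teta }.

Definition nu_set (T : transduction) (G : graph)
  (col : 'I_(gn G) -> 'I_(tk T) -> bool) : {set 'I_(gn G)} :=
  [set v | sat col (asg1 v) (tnu T)].

Definition interp (T : transduction) (G : graph)
  (col : 'I_(gn G) -> 'I_(tk T) -> bool) : graph :=
  @Graph #|@nu_set T G col|
    (fun i j => sat col (asg2 (enum_val i) (enum_val j)) (teta T))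
    (fun i j => @teta_sym T G col (enum_val i) (enum_val j))
    (fun i => negbTE (@teta_irr T G col (enum_val i))).

Definition tapp (T : transduction) (G : graph) : gclass :=
  fun H => exists col : 'I_(gn G) -> 'I_(tk T) -> bool, iso H (@interp T G col).

Definition tapp_class (T : transduction) (D : gclass) : gclass :=
  fun H => exists G, D G /\ tapp T G H.

Definition hprop := gclass -> Prop.

Definition is_hereditary_property (P : hprop) : Prop :=
  (forall C, P C -> hereditary C) /\
  (forall C D, P C -> hereditary D -> (forall G, D G -> C G) -> P D).

Definition nondecreasing (f : nat -> nat) : Prop :=
  forall m n, m <= n -> f m <= f n.

(** f(n) = n^{o(1)}: for every k >= 1, eventually f(n) <= n^{1/k}. *)
Definition subpoly (f : nat -> nat) : Prop :=
  forall k, 0 < k -> exists n0, forall n, n0 <= n -> f n ^ k <= n.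

Definition has_decomp (f : nat -> nat) (p : nat) (Dp : gclass) (C : gclass)
  : Prop :=
  forall G, C G ->
    exists N, N <= f (gn G) /\
    exists c : 'I_(gn G) -> 'I_N,
      forall t : 'I_p -> 'I_N,
        Dp (induced [set v | [exists i, c v == t i]]).

Definition star (P : hprop) : hprop :=
  fun C => hereditary C /\
    forall p, 0 < p ->
      exists f, nondecreasing f /\ subpoly f /\
      exists Dp, P Dp /\ has_decomp f p Dp C.

Definition decomposition_horizon (P : hprop) : Prop :=
  forall C, star P C <-> P C.

Definition bdeg_transd : hprop :=
  fun C => hereditary C /\
    exists (D : gclass) (d : nat),
      (forall G, D G -> forall v : 'I_(gn G), deg v <= d) /\
      exists T : transduction, forall H, C H -> tapp_class T D H.

(* Main.v *)
Require Import Defs.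
From mathcomp Require Import all_boot.
From mathcomp Require Import zify.

Set Implicit Arguments.
Unset Strict Implicit.
Unset Printing Implicit Defensive.

(** Call a graph (K, L)-spread if it has K vertices whose neighbourhoods pairwise differ
    in more than L vertices.

    A Hanf-style back-and-forth argument inside a single graph shows that, at bounded
    degree, the edges of an interpretation between far apart vertices depend only on the
    isomorphism types of bounded coloured balls, of which there are boundedly many; so a
    transduction of a bounded degree class has no (K, L)-spread member, for some K, L.
    Conversely, in a graph that is not (K, L)-spread, boundedly many vertices represent
    all neighbourhoods up to few errors, and complementing the adjacency between some of
    the resulting boundedly many vertex classes leaves a graph of bounded degree.

    A graph spread with huge parameters contains vertices r_1, ..., r_m and m-sets
    S_1, ..., S_m such that every vertex of S_i tells r_i apart from r_(i+1), ..., r_m.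
    This configuration has at most m + m^2 vertices, so if these are coloured with m^o(1)
    colours, then two colours already contain a large spread configuration. Hence a
    decomposition with parameter p = 2 suffices. *)

(** * Balls *)

Section Balls.
Variable G : graph.
Local Notation V := 'I_(gn G).
Implicit Types (A B X Y : {set V}) (u v w : V).

Definition nbhd A : {set V} := A :|: [set v | [exists u in A, gadj u v]].
Definition ball r A : {set V} := iter r nbhd A.

Lemma ballP r A w :
  reflect (w \in ball r A \/ exists2 u, u \in ball r A & gadj u w)
          (w \in ball r.+1 A).
Proof.
rewrite /ball iterS -/(ball r A) !inE; apply: (iffP orP).
  by case=> [|/exists_inP]; [left | right].
by case=> [|/exists_inP]; [left | right].
Qed.

Lemma ball_add r s A : ball (r + s) A = ball r (ball s A).
Proof. exact: iterD. Qed.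

Lemma ballS r A B : A \subset B -> ball r A \subset ball r B.
Proof.
move=> sAB; elim: r => // r IH; apply/subsetP=> w /ballP[wA|[u uA uw]].
  by apply/ballP; left; apply: (subsetP IH).
by apply/ballP; right; exists u => //; apply: (subsetP IH).
Qed.

Lemma sub_ball r A : A \subset ball r A.
Proof.
by elim: r => // r IH; apply: (subset_trans IH); apply/subsetP=> w; rewrite !inE => ->.
Qed.

Lemma ball_leq r s A : r <= s -> ball r A \subset ball s A.
Proof. by move=> /subnKC <-; rewrite addnC ball_add sub_ball. Qed.

Lemma ballU r A B : ball r (A :|: B) = ball r A :|: ball r B.
Proof.
apply/eqP; rewrite eqEsubset subUset !ballS ?subsetUl ?subsetUr // !andbT.
elim: r => // r IH; apply/subsetP=> w /ballP[|[u]] /(subsetP IH).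
  by rewrite !inE => /orP[] ->; rewrite ?orbT.
move=> /setUP[] ru uw; apply/setUP; [left | right]; apply/ballP; right;
  by exists u.
Qed.

Lemma ball_sym r v w : w \in ball r [set v] -> v \in ball r [set w].
Proof.
elim: r w => [|r IH] w; first by rewrite !inE eq_sym.
have sub u : u \in ball 1 [set w] -> ball r [set u] \subset ball r.+1 [set w].
  by move=> uw; rewrite -(addn1 r) ball_add ballS // sub1set.
move=> /ballP[/IH|[u /IH uv uw]].
  by apply/subsetP/sub; apply: (subsetP (sub_ball _ _)); rewrite set11.
apply: (subsetP (sub u _)) uv; apply/ballP; right; exists w; first exact: set11.
by rewrite gsym.
Qed.

Lemma ball_trans r s A v w :
  w \in ball r [set v] -> w \in ball s A -> v \in ball (r + s) A.
Proof.
move=> /ball_sym wv ws; rewrite ball_add; apply: (subsetP _ _ wv).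
by rewrite ballS // sub1set.
Qed.

Definition separated X Y :=
  forall x y, x \in X -> y \in Y -> (x == y) = false /\ gadj x y = false.

(** A common vertex of the two balls, or an edge between them, would give a path of length at most
    [2 * r + 1] from [v] to [A]. *)
Lemma far_separated r A v :
  v \notin ball (r + r.+1) A -> separated (ball r [set v]) (ball r A).
Proof.
move=> far x y xv yA; split; apply: contraNF far => xy; apply: (ball_trans xv).
  by apply/ballP; left; rewrite (eqP xy).
by apply/ballP; right; exists y; rewrite // gsym.
Qed.

Lemma card_ball d r A :
  (forall v : V, deg v <= d) -> #|ball r A| <= #|A| * d.+1 ^ r.
Proof.
move=> degd; elim: r => [|r IH]; first by rewrite muln1.
have: #|ball r.+1 A| <= #|ball r A| * d.+1.
  rewrite /ball iterS -/(ball r A); apply: (leq_trans (leq_card_setU _ _)).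
  rewrite mulnS leq_add2l; set B := ball r A.
  apply: (@leq_trans #|\bigcup_(u in B) [set v | gadj u v]|).
    apply: subset_leq_card; apply/subsetP=> v; rewrite inE => /exists_inP[u uB uv].
    by apply/bigcupP; exists u => //; rewrite inE.
  apply: (@leq_trans (\sum_(u in B) d)); last by rewrite sum_nat_const.
  elim/big_rec2: _ => [|u m S _ le]; first by rewrite cards0.
  by apply: (leq_trans (leq_card_setU _ _)); rewrite leq_add // degd.
move=> H; apply: (leq_trans H); rewrite expnSr mulnA leq_mul2r IH orbT //.
Qed.

End Balls.

(** * Locality of first-order formulas *)

Section Locality.
Variables (k : nat) (G : graph) (col : 'I_(gn G) -> 'I_k -> bool).
Local Notation V := 'I_(gn G).
Implicit Types (A B X Y Z : {set V}) (u v w : V) (f g : V -> V) (a b : nat -> V).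

(** Isomorphism of the coloured subgraphs induced on [X] and [Y]. The maps are total and constrained
    only on these sets, so they restrict, compose and glue without dependent types. *)
Record liso X Y f g : Prop := Liso {
  liso_to : forall x, x \in X -> f x \in Y;
  liso_from : forall y, y \in Y -> g y \in X;
  liso_fK : {in X, cancel f g};
  liso_gK : {in Y, cancel g f};
  liso_adj : {in X &, forall x y, gadj (f x) (f y) = gadj x y};
  liso_col : {in X, forall x, col (f x) =1 col x} }.

Lemma liso_sym X Y f g : liso X Y f g -> liso Y X g f.
Proof.
case=> fX gY fK gK fadj fcol; split=> // [x y xY yY | x xY c].
  by rewrite -fadj ?gK ?gY.
by rewrite -fcol ?gK ?gY.
Qed.

Lemma liso_id X : liso X X id id.
Proof. by split. Qed.

Lemma liso_comp X Y Z f1 g1 f2 g2 :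
  liso X Y f1 g1 -> liso Y Z f2 g2 -> liso X Z (f2 \o f1) (g1 \o g2).
Proof.
case=> fX gY fK gK fadj fcol [fX2 gY2 fK2 gK2 fadj2 fcol2].
split=> [x xX | y yZ | x xX | y yZ | x y xX yX | x xX c] /=.
- exact/fX2/fX.
- exact/gY/gY2.
- by rewrite fK2 ?fX ?fK.
- by rewrite gK ?gY2 ?gK2.
- by rewrite fadj2 ?fX ?fadj.
- by rewrite fcol2 ?fX ?fcol.
Qed.

Lemma liso_ball X Y f g r A B :
    liso X Y f g -> ball r A \subset X -> (forall x, x \in A -> f x \in B) ->
  forall x, x \in ball r A -> f x \in ball r B.
Proof.
move=> fg; elim: r => // r IH sub fAB x.
have {}sub' : ball r A \subset X by apply: subset_trans (ball_leq _ _) sub.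
move=> /ballP[/(IH sub' fAB) fx|[u uA ux]]; apply/ballP; [by left | right].
exists (f u); first exact: IH.
rewrite (liso_adj fg) //; first exact: (subsetP sub').
by apply/(subsetP sub)/ballP; right; exists u.
Qed.

Lemma liso_restrict X Y f g r A B :
    liso X Y f g -> ball r A \subset X -> ball r B \subset Y ->
    (forall x, x \in A -> f x \in B) -> (forall y, y \in B -> g y \in A) ->
  liso (ball r A) (ball r B) f g.
Proof.
move=> fg sX sY fA gB; split.
- exact: liso_ball fg sX fA.
- exact: liso_ball (liso_sym fg) sY gB.
- by move=> x /(subsetP sX) /(liso_fK fg).
- by move=> y /(subsetP sY) /(liso_gK fg).
- by move=> x y /(subsetP sX) xX /(subsetP sX) yX; apply: liso_adj fg _ _ xX yX.
- by move=> x /(subsetP sX) /(liso_col fg).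
Qed.

Definition glue X f g x := if x \in X then f x else g x.

Lemma glue_out X Y f g x :
  separated X Y -> x \in Y -> glue X f g x = g x.
Proof.
by move=> sep xY; rewrite /glue ifN //; apply/negP=> xX; have [] := sep x x xX xY; rewrite eqxx.
Qed.

Lemma glue_in X f g x : x \in X -> glue X f g x = f x.
Proof. by rewrite /glue => ->. Qed.

(** Pairs crossing between the pieces are distinct and non-adjacent on both sides, so the two
    isomorphisms need no compatibility. *)
Lemma liso_glue X1 Y1 f1 g1 X2 Y2 f2 g2 :
    liso X1 Y1 f1 g1 -> liso X2 Y2 f2 g2 -> separated X1 X2 -> separated Y1 Y2 ->
  liso (X1 :|: X2) (Y1 :|: Y2) (glue X1 f1 f2) (glue Y1 g1 g2).
Proof.
move=> [fX1 gY1 fK1 gK1 adj1 col1] [fX2 gY2 fK2 gK2 adj2 col2] sX sY.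
have oX := glue_out _ _ sX; have oY := glue_out _ _ sY.
split.
- move=> x /setUP[] xX; rewrite inE ?(glue_in _ _ xX) ?oX //.
    by rewrite fX1.
  by rewrite fX2 ?orbT.
- move=> x /setUP[] xX; rewrite inE ?(glue_in _ _ xX) ?oY //.
    by rewrite gY1.
  by rewrite gY2 ?orbT.
- move=> x /setUP[] xX; rewrite ?(glue_in _ _ xX) ?oX //.
    by rewrite glue_in ?fX1 ?fK1.
  by rewrite oY ?fX2 ?fK2.
- move=> x /setUP[] xX; rewrite ?(glue_in _ _ xX) ?oY //.
    by rewrite glue_in ?gY1 ?gK1.
  by rewrite oX ?gY2 ?gK2.
- move=> x y /setUP[] xX /setUP[] yX;
    rewrite ?(glue_in _ _ xX) ?(glue_in _ _ yX) ?oX //.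
  + exact: adj1.
  + by rewrite (sX _ _ xX yX).2 (sY _ _ (fX1 _ xX) (fX2 _ yX)).2.
  + by rewrite gsym [RHS]gsym (sX _ _ yX xX).2 (sY _ _ (fX1 _ yX) (fX2 _ xX)).2.
  + exact: adj2.
- move=> x /setUP[] xX c; rewrite ?(glue_in _ _ xX) ?oX //.
    exact: col1.
  exact: col2.
Qed.

(* The orbit of [v] under [g] cannot stay inside [Y], because [g] maps [Y]
   injectively into [X], which misses [v]. *)
Lemma liso_escape X Y f g (T : V -> Prop) v :
    liso X Y f g -> (forall y, y \in Y -> T y -> T (g y)) ->
    v \notin X -> T v ->
  exists2 v', v' \notin Y & T v'.
Proof.
move=> fg Tg vX Tv; pose h x := if x \in Y then g x else x.
have Th x : T x -> T (h x) by rewrite /h; case: ifP => // xY; apply: Tg.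
pose O := [set w | fconnect h v w].
have TO w : w \in O -> T w.
  by rewrite inE => /iter_findex <-; elim: (findex _ _ _) => //= n /Th.
have [sOY|] := boolP (O \subset Y); last first.
  by case/subsetPn=> w /TO Tw wY; exists w.
have gO : [set g x | x in O] \subset O :\ v.
  apply/subsetP=> _ /imsetP[x xO ->]; have xY := subsetP sOY x xO.
  rewrite !inE; apply/andP; split.
    by apply: contraNneq vX => <-; apply: liso_from fg _ xY.
  have -> : g x = h x by rewrite /h xY.
  by move: xO; rewrite inE => /connect_trans; apply; apply: fconnect1.
have := subset_leq_card gO; rewrite card_in_imset => [|x y xO yO]; last first.
  by move/(can_in_inj (liso_gK fg)); apply; apply: (subsetP sOY).
by rewrite [X in X <= _](cardsD1 v) inE connect0 ltnn.
Qed.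

Definition range n a : {set V} := [set a i | i : 'I_n].

Lemma rangeP n a w : reflect (exists2 i, i < n & w = a i) (w \in range n a).
Proof.
apply: (iffP imsetP) => [[i _ ->]|[i ltin ->]]; first by exists i.
by exists (Ordinal ltin).
Qed.

Lemma mem_range n a i : i < n -> a i \in range n a.
Proof. by move=> ltin; apply/rangeP; exists i. Qed.

(** A position of the Ehrenfeucht-Fraisse game with the same coloured graph as both boards. *)
Definition sim R n a b :=
  exists f g, liso (ball R (range n a)) (ball R (range n b)) f g /\
    forall i, i < n -> f (a i) = b i.

Lemma simI R n a b X Y f g :
    liso X Y f g -> ball R (range n a) \subset X -> ball R (range n b) \subset Y ->
    (forall i, i < n -> f (a i) = b i) ->
  sim R n a b.
Proof.
move=> fg sX sY fab; exists f, g; split=> //; apply: (liso_restrict fg sX sY).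
  by move=> _ /rangeP[i ltin ->]; rewrite fab // mem_range.
move=> _ /rangeP[i ltin ->]; rewrite -fab // (liso_fK fg) ?mem_range //.
exact/(subsetP sX)/(subsetP (sub_ball _ _))/mem_range.
Qed.

Lemma sim_sym R n a b : sim R n a b -> sim R n b a.
Proof.
case=> f [g [fg fab]]; apply: (simI (liso_sym fg)) => // i ltin.
by rewrite -fab // (liso_fK fg) //; apply/(subsetP (sub_ball _ _))/mem_range.
Qed.

Lemma range_upd n a x v : range n (upd a x v) \subset v |: range n a.
Proof.
apply/subsetP=> _ /rangeP[i ltin ->]; rewrite /upd.
by case: eqP => _; rewrite !inE ?eqxx ?mem_range ?orbT.
Qed.

(** Duplicator's answer: a [v] within distance [2 * r + 1] of [A] is sent along [f]; otherwise any
    vertex far from [B] with the same [r]-ball type will do, because its ball glues to the old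
    ones. *)
Lemma sim_upd r n a b x v :
  sim (r + (r + r.+1)) n a b -> exists v', sim r n (upd a x v) (upd b x v').
Proof.
set s := r + r.+1; set A := range n a; set B := range n b.
case=> f [g [fg fab]].
have gab i : i < n -> g (b i) = a i.
  by move=> ltin; rewrite -fab // (liso_fK fg) //; apply/(subsetP (sub_ball _ _))/mem_range.
have fA y : y \in A -> f y \in B.
  by case/rangeP=> i ltin ->; rewrite fab ?mem_range.
have gB y : y \in B -> g y \in A.
  by case/rangeP=> i ltin ->; rewrite gab ?mem_range.
have sle (C : {set V}) : ball s C \subset ball (r + s) C by rewrite ball_leq // leq_addl.
have fs y : y \in ball s A -> f y \in ball s B.
  exact: (liso_ball fg).
have gs y : y \in ball s B -> g y \in ball s A.
  exact: (liso_ball (liso_sym fg)).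
have sub1 (C : {set V}) w : w \in ball s C -> w |: C \subset ball s C.
  by move=> wC; rewrite subUset sub1set wC sub_ball.
have [vA|vA] := boolP (v \in ball s A).
  exists (f v); apply: (simI fg).
  - by rewrite ball_add ballS //; apply: subset_trans (range_upd _ _ _ _) (sub1 _ _ vA).
  - rewrite ball_add ballS //; apply: subset_trans (range_upd _ _ _ _) (sub1 _ _ _).
    exact: fs.
  - by move=> i ltin; rewrite /upd; case: eqP => // _; apply: fab.
(* [T w] says that [w] has the rooted coloured [r]-ball of [v]. On [ball s B] the map [g] preserves
   this, since [r]-balls around such points stay inside radius [r + s]. *)
pose T w := exists f2 g2, liso (ball r [set v]) (ball r [set w]) f2 g2 /\ f2 v = w.
have Tv : T v by exists id, id; split=> //; apply: liso_id.
have Tg y : y \in ball s B -> T y -> T (g y).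
  move=> yB [f2 [g2 [fg2 f2v]]].
  have ls : liso (ball r [set y]) (ball r [set g y]) g f.
    apply: (liso_restrict (liso_sym fg)).
    - by rewrite ball_add ballS // sub1set.
    - by rewrite ball_add ballS // sub1set gs.
    - by move=> x0 /set1P ->; rewrite set11.
    - by move=> x0 /set1P ->; rewrite (liso_gK fg) ?set11 // (subsetP (sle _)).
  by exists (g \o f2), (g2 \o f); split; [exact: liso_comp fg2 ls | rewrite /= f2v].
have lsAB : liso (ball s A) (ball s B) f g by apply: (liso_restrict fg).
have [v' vB [f2 [g2 [fg2 f2v]]]] := liso_escape lsAB Tg vA Tv.
have rle (C : {set V}) : ball r C \subset ball (r + s) C by rewrite ball_leq // leq_addr.
have lr : liso (ball r A) (ball r B) f g by apply: (liso_restrict fg).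
have sA := far_separated vA; have sB := far_separated vB.
exists v'; apply: (simI (liso_glue fg2 lr sA sB)).
- by rewrite -ballU ballS // range_upd.
- by rewrite -ballU ballS // range_upd.
- move=> i ltin; rewrite /upd; case: eqP => _.
    by rewrite glue_in ?f2v //; apply/(subsetP (sub_ball _ _))/set11.
  rewrite (glue_out _ _ sA) ?fab //.
  exact/(subsetP (sub_ball _ _))/mem_range.
Qed.

Fixpoint qrank (phi : form k) : nat :=
  match phi with
  | FEdge _ _ | FEq _ _ | FCol _ _ => 0
  | FNot p => qrank p
  | FAnd p q | FOr p q => maxn (qrank p) (qrank q)
  | FEx _ p | FAll _ p => (qrank p).+1
  end.

Fixpoint var_bound (phi : form k) : nat :=
  match phi with
  | FEdge x y | FEq x y => maxn x.+1 y.+1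
  | FCol _ x => x.+1
  | FNot p => var_bound p
  | FAnd p q | FOr p q => maxn (var_bound p) (var_bound q)
  | FEx _ p | FAll _ p => var_bound p
  end.

(** Iterates the radius loss of [sim_upd], one round per quantifier; in closed form
    [(3 ^ q - 1) / 2]. *)
Fixpoint radius q := if q is q'.+1 then radius q' + (radius q' + (radius q').+1) else 0.

(** Each quantifier is one round of the game. As [var_bound] also counts bound variables occurring
    in atoms, [n] stays fixed during the induction. *)
Lemma sim_sat n phi : var_bound phi <= n ->
  forall q a b, qrank phi <= q -> sim (radius q) n a b -> sat col a phi = sat col b phi.
Proof.
elim: phi => [x y|x y|c x|p IH|p IHp p' IHp'|p IHp p' IHp'|x p IH|x p IH] /=;
  rewrite ?geq_max => vb q a b.
- case/andP: vb => xn yn _ [f [g [fg fab]]]; rewrite -!fab // (liso_adj fg) //;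
  exact/(subsetP (sub_ball _ _))/mem_range.
- case/andP: vb => xn yn _ [f [g [fg fab]]]; rewrite -!fab //.
  by rewrite (inj_in_eq (can_in_inj (liso_fK fg))) //;
     apply/(subsetP (sub_ball _ _))/mem_range.
- move=> _ [f [g [fg fab]]]; rewrite -!fab // (liso_col fg) //.
  exact/(subsetP (sub_ball _ _))/mem_range.
- by move=> qr ab; rewrite (IH vb q a b).
- case/andP: vb => v1 v2; rewrite geq_max => /andP[q1 q2] ab.
  by rewrite (IHp v1 q a b) ?(IHp' v2 q a b).
- case/andP: vb => v1 v2; rewrite geq_max => /andP[q1 q2] ab.
  by rewrite (IHp v1 q a b) ?(IHp' v2 q a b).
- case: q => // q qr ab; apply/existsP/existsP => -[v].
    have [v' ab'] := sim_upd x v ab.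
    by rewrite (IH vb q _ _ qr ab'); exists v'.
  have [v' ab'] := sim_upd x v (sim_sym ab).
  by rewrite (IH vb q _ _ qr ab'); exists v'.
- case: q => // q qr ab; apply/forallP/forallP => H v.
    have [v' ab'] := sim_upd x v (sim_sym ab).
    by rewrite (IH vb q _ _ qr ab').
  have [v' ab'] := sim_upd x v ab.
  by rewrite (IH vb q _ _ qr ab').
Qed.

End Locality.

(** * Interpretations in bounded degree graphs *)

Section BallCodes.
Variables (k : nat) (G : graph) (col : 'I_(gn G) -> 'I_k -> bool) (r M : nat).
Local Notation V := 'I_(gn G).
Implicit Types u v : V.

Let benum u := enum (ball r [set u]).

(* Determines the coloured [r]-ball around [u], rooted at [u], up to isomorphism,
   provided the ball has at most [M] vertices. *)
Definition ball_code u :=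
  ([ffun p : 'I_M * 'I_M => gadj (nth u (benum u) p.1) (nth u (benum u) p.2)],
   [ffun p : 'I_M * 'I_k => col (nth u (benum u) p.1) p.2],
   inord (size (benum u)) : 'I_M.+1, inord (index u (benum u)) : 'I_M.+1).

Lemma ball_code_liso u u' :
    #|ball r [set u]| <= M -> #|ball r [set u']| <= M -> ball_code u = ball_code u' ->
  exists f g, liso col (ball r [set u]) (ball r [set u']) f g /\ f u = u'.
Proof.
rewrite !cardE -/(benum u) -/(benum u') => le le' [/ffunP eadj /ffunP ecol esz eidx].
have {}esz : size (benum u) = size (benum u').
  by move/(congr1 val): esz; rewrite /= !inordK.
have mem v w : (w \in benum v) = (w \in ball r [set v]) by rewrite mem_enum.
have root v : v \in benum v by rewrite mem; apply/(subsetP (sub_ball _ _))/set11.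
have {}eidx : index u (benum u) = index u' (benum u').
  move/(congr1 val): eidx; rewrite /= !inordK // ltnS.
    by apply: leq_trans le'; rewrite ltnW ?index_mem.
  by apply: leq_trans le; rewrite ltnW ?index_mem.
pose f w := nth u' (benum u') (index w (benum u)).
pose g w := nth u (benum u) (index w (benum u')).
have ltM w : w \in benum u -> index w (benum u) < M.
  by move=> wu; apply: leq_trans le; rewrite index_mem.
have un v : uniq (benum v) by rewrite enum_uniq.
exists f, g; split; last by rewrite /f eidx nth_index.
split=> [x|x|x|x|x y|x]; rewrite -!mem /f /g.
- by move=> xu; rewrite mem_nth // -esz index_mem.
- by move=> xu; rewrite mem_nth // esz index_mem.
- by move=> xu; rewrite index_uniq ?nth_index // -esz index_mem.
- by move=> xu; rewrite index_uniq ?nth_index // esz index_mem.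
- move=> xu yu; have := eadj (Ordinal (ltM _ xu), Ordinal (ltM _ yu)).
  by rewrite !ffunE /= !nth_index.
- move=> xu c; have := ecol (Ordinal (ltM _ xu), c).
  by rewrite !ffunE /= nth_index.
Qed.

End BallCodes.

Definition spread K L (G : graph) :=
  exists A : {set 'I_(gn G)}, K <= #|A| /\
    {in A &, forall u v, u != v -> L < #|[set w | gadj u w != gadj v w]|}.

Lemma spread_embeds K L H G : embeds H G -> spread K L H -> spread K L G.
Proof.
case=> f [f_inj fadj] [A [leKA sA]]; exists (f @: A); split; first by rewrite card_imset.
move=> _ _ /imsetP[u uA ->] /imsetP[v vA ->]; rewrite (inj_eq f_inj) => uv.
apply: leq_trans (sA u v uA vA uv) _; rewrite -(card_imset _ f_inj).
apply/subset_leq_card/subsetP=> _ /imsetP[w + ->].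
by rewrite !inE -!fadj.
Qed.

Lemma iso_embeds H G : iso H G -> embeds H G.
Proof. by case=> f [/bij_inj f_inj fadj]; exists f. Qed.

Lemma transduction_no_spread (T : transduction) d :
  exists K L, forall G : graph, (forall v : 'I_(gn G), deg v <= d) ->
    forall col, ~ spread K L (@interp T G col).
Proof.
pose n := var_bound (teta T); pose r := radius (qrank (teta T)).
pose M := d.+1 ^ r; pose s := r + r.+1.
pose codeT : finType :=
  ({ffun 'I_M * 'I_M -> bool} * {ffun 'I_M * 'I_(tk T) -> bool} * 'I_M.+1 * 'I_M.+1)%type.
(* [K] exceeds the number of ball codes, so two vertices of [A] share one; [L] bounds the union of
   their [s]-balls, outside which they have the same neighbours. *)
exists #|codeT|.+1, (d.+1 ^ s + d.+1 ^ s) => G degd col [A [leA sA]].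
have cb t (u : 'I_(gn G)) : #|ball t [set u]| <= d.+1 ^ t.
  by have := card_ball t [set u] degd; rewrite cards1 mul1n.
pose code i : codeT := ball_code col r M (enum_val (i : 'I_#|nu_set col|)).
have : ~~ dinjectiveb code [in A].
  apply: contraL leA => /dinjectiveP inj.
  by rewrite -leqNgt -(card_in_imset inj) max_card.
case/dinjectivePn=> i iA [j /andP[/= ji jA]] /(ball_code_liso (cb r _) (cb r _)).
set u := enum_val i; set v := enum_val j => -[f [g [fg fu]]].
have := sA j i jA iA ji; rewrite ltnNge => /negP; apply.
rewrite -(card_imset _ enum_val_inj).
apply: (@leq_trans #|ball s [set u] :|: ball s [set v]|); last first.
  by apply: leq_trans (leq_card_setU _ _) (leq_add (cb _ _) (cb _ _)).
apply/subset_leq_card/subsetP=> _ /imsetP[l + ->]; rewrite !inE /= -/u -/v.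
move: (enum_val l) => w; apply: contraNT; rewrite negb_or => /andP[wu wv].
apply/eqP/esym/(@sim_sat _ _ col n (teta T) (leqnn _) _ _ _ (leqnn _)).
have sep x : w \notin ball s [set x] -> separated (ball r [set x]) (ball r [set w]).
  by move=> wx; apply: far_separated; apply: contraNN wx => /ball_sym.
(* [u] is exchanged for [v] while the ball around [w] stays fixed. *)
apply: (simI (liso_glue fg (liso_id col (ball r [set w])) (sep _ wu) (sep _ wv))).
- rewrite -ballU ballS //; apply/subsetP=> _ /rangeP[m _ ->].
  by rewrite /asg2; case: eqP; rewrite !inE eqxx ?orbT.
- rewrite -ballU ballS //; apply/subsetP=> _ /rangeP[m _ ->].
  by rewrite /asg2; case: eqP; rewrite !inE eqxx ?orbT.
- move=> m _; rewrite /asg2; case: eqP => _.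
    by rewrite glue_in //; apply/(subsetP (sub_ball _ _))/set11.
  by rewrite (glue_out _ _ (sep _ wu)) //; apply/(subsetP (sub_ball _ _))/set11.
Qed.

Lemma bdeg_transd_no_spread C :
  bdeg_transd C -> exists K L, forall G, C G -> ~ spread K L G.
Proof.
case=> _ [D [d [degD [T CT]]]]; have [K [L noKL]] := transduction_no_spread T d.
exists K, L => H /CT[G [DG [col HG]]] /(spread_embeds (iso_embeds HG)).
exact/noKL/degD.
Qed.

(** * Chains *)

Lemma pigeonhole (T T' : finType) (A : {set T}) (B : {set T'}) (f : T -> T') n :
    (forall x, x \in A -> f x \in B) -> #|B| * n < #|A| ->
  exists2 y, y \in B & n < #|[set x in A | f x == y]|.
Proof.
move=> fAB; rewrite ltnNge => H; apply/exists_inP; apply: contraNT H.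
rewrite negb_exists => /forallP small.
rewrite -sum1_card (partition_big f [in B]) //= -sum_nat_const.
apply: leq_sum => y yB; move: (small y); rewrite yB -leqNgt; apply: leq_trans.
by rewrite -sum1_card; apply/eq_leq/eq_bigl=> x; rewrite inE.
Qed.

Lemma subset_of_card (T : finType) (A : {set T}) n :
  n <= #|A| -> exists2 B : {set T}, B \subset A & #|B| = n.
Proof.
case/card_geqP=> s [us <- sA]; exists [set x in s].
  by apply/subsetP=> x; rewrite inE => /sA.
by rewrite cardsE (card_uniqP us).
Qed.

Lemma card_preim_enum_val (T : finType) (X B : {set T}) :
  B \subset X -> #|(@enum_val T [in X]) @^-1: B| = #|B|.
Proof.
move=> sBX; rewrite -(card_imset _ enum_val_inj); apply: eq_card => x.
apply/imsetP/idP => [[i + ->]|xB]; first by rewrite inE.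
have xX := subsetP sBX x xB; exists (enum_rank_in xX x); last by rewrite enum_rankK_in.
by rewrite inE enum_rankK_in.
Qed.

Lemma induced_embeds (G : graph) (X : {set 'I_(gn G)}) : embeds (induced X) G.
Proof. by exists enum_val; split=> //; apply: enum_val_inj. Qed.

(* [S i] tells [r i] apart from every later [r j]; unlike being pairwise far apart,
   this survives a colouring of the vertices with a polynomial loss only. *)
Definition chain m s (G : graph) :=
  exists (r : nat -> 'I_(gn G)) (S : nat -> {set 'I_(gn G)}),
    (forall i, i < m -> #|S i| = s) /\
    (forall i j w, i < j < m -> w \in S i -> gadj (r i) w != gadj (r j) w).

(** Among the vertices telling [x] from [y], more than [s] have the same trace [Z] on [A]; [s] of
    them form the first [S]. Whichever of [Z] and [A :\: Z] still has [2 ^ m] elements feeds the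
    induction, and the first [r] comes from the other. *)
Lemma far_chain m s B (G : graph) (A : {set 'I_(gn G)}) :
    {in A &, forall u v, u != v -> 2 ^ B * s < #|[set w | gadj u w != gadj v w]|} ->
    2 ^ m <= #|A| -> #|A| <= B ->
  exists (r : nat -> 'I_(gn G)) (S : nat -> {set 'I_(gn G)}),
  [/\ forall i, i < m -> r i \in A, forall i, i < m -> #|S i| = s
    & forall i j w, i < j < m -> w \in S i -> gadj (r i) w != gadj (r j) w].
Proof.
elim: m A => [|m IH] A farA leA leB.
  case/card_gt0P: (leA) => x xA; exists (fun=> x), (fun=> set0).
  by split=> // i j w; rewrite ltn0 andbF.
have [x [y [xA yA xy]]] : exists x y, [/\ x \in A, y \in A & x != y].
  by apply/card_gt1P; apply: leq_trans leA; rewrite expnS; have := expn_gt0 2 m; lia.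
pose tr w := [set z in A | gadj z w].
have [Z _ bigZ] : exists2 Z, Z \in powerset A &
    s < #|[set w in [set w | gadj x w != gadj y w] | tr w == Z]|.
  apply: pigeonhole => [w _|]; first by rewrite inE; apply/subsetP=> z; rewrite inE => /andP[].
  rewrite card_powerset; apply: leq_ltn_trans (farA x y xA yA xy).
  by rewrite leq_mul2r leq_exp2l ?leB ?orbT.
have [S sS cS] := subset_of_card (ltnW bigZ).
have SZ w : w \in S -> forall z, z \in A -> gadj z w = (z \in Z).
  by move=> /(subsetP sS); rewrite !inE => /andP[_ /eqP <-] z zA; rewrite inE zA.
have sZA : Z \subset A.
  case/card_gt0P: (leq_ltn_trans (leq0n _) bigZ) => w; rewrite inE => /andP[_ /eqP <-].
  by apply/subsetP=> z; rewrite inE => /andP[].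
have xyZ : (x \in Z) != (y \in Z).
  case/card_gt0P: (leq_ltn_trans (leq0n _) bigZ) => w.
  by rewrite !inE => /andP[xyw /eqP <-]; rewrite !inE xA yA.
(* Puts [z] in front of a chain inside [Q]: each vertex of [S] sees exactly [Z] within [A], so it
   tells [z] from all of [Q]. *)
have extend z (Q : {set 'I_(gn G)}) : z \in A -> Q \subset A -> 2 ^ m <= #|Q| ->
    (forall q, q \in Q -> (q \in Z) != (z \in Z)) ->
    exists (r : nat -> 'I_(gn G)) (S : nat -> {set 'I_(gn G)}),
    [/\ forall i, i < m.+1 -> r i \in A, forall i, i < m.+1 -> #|S i| = s
      & forall i j w, i < j < m.+1 -> w \in S i -> gadj (r i) w != gadj (r j) w].
  move=> zA sQA leQ zQ.
  have [||r [T [rQ cT sepT]]] := IH Q _ leQ.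
  - by move=> u v /(subsetP sQA) uA /(subsetP sQA); apply: farA.
  - by apply: leq_trans leB; apply: subset_leq_card.
  exists (fun i => if i is i'.+1 then r i' else z).
  exists (fun i => if i is i'.+1 then T i' else S).
  split=> [[|i]|[|i]|[|i] [|j] w] //=.
  - by move=> im; apply/(subsetP sQA)/rQ.
  - exact: cT.
  - move=> jm wS; have rj := rQ j jm.
    by rewrite !SZ // ?(subsetP sQA) // eq_sym zQ.
  - exact: sepT.
have [z zZ] : exists z, z \in Z.
  by case xZ : (x \in Z) xyZ; [exists x | case yZ : (y \in Z) => // _; exists y].
have [z' z'A z'Z] : exists2 z, z \in A & z \notin Z.
  by case xZ : (x \in Z) xyZ => xyZ; [exists y; rewrite // -[_ \in _]negbK | exists x; rewrite ?xZ].
have [leZ|ltZ] := leqP (2 ^ m) #|Z|.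
  by apply: (extend z' Z) => // q qZ; rewrite qZ (negbTE z'Z).
apply: (extend z (A :\: Z)); first exact: (subsetP sZA).
- exact: subsetDl.
- have := cardsID Z A; rewrite (setIidPr sZA); move: leA; rewrite expnS; lia.
- by move=> q /setDP[_ /negbTE ->]; rewrite zZ.
Qed.

(** [A] is first cut down to exactly [2 ^ m] vertices, which bounds the number of traces. *)
Lemma spread_chain m s (G : graph) : spread (2 ^ m) (2 ^ (2 ^ m) * s) G -> chain m s G.
Proof.
case=> A [/subset_of_card[A' sA' cA'] farA].
have [||| r [S [_ cS sepS]]] := @far_chain m s (2 ^ m) G A'; rewrite ?cA' //.
  by move=> u v /(subsetP sA') uA /(subsetP sA'); apply: farA.
by exists r, S.
Qed.

(** Bounds the order in terms of [m] and [s], so that the number of colours in a decomposition does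
    not depend on the order of [G]. *)
Lemma chain_induced m s (G : graph) : 0 < m -> chain m s G ->
  exists H, [/\ embeds H G, gn H <= m + m * s & chain m s H].
Proof.
move=> m_gt0 [r [S [cS sepS]]].
pose W := \bigcup_(i < m) (r i |: S i).
have WU i : i < m -> (r i |: S i) \subset W by move=> im; apply: (bigcup_sup (Ordinal im)).
have rW i : i < m -> r i \in W by move=> im; apply/(subsetP (WU i im))/setU11.
have SW i : i < m -> S i \subset W by move=> im; apply: subset_trans (WU i im); apply: subsetUr.
exists (induced W); split; first exact: induced_embeds.
  rewrite -mulnS -[m in m * _]card_ord -sum_nat_const /= /W.
  elim/big_ind2: _ => [|X a Y b ? ?|i _]; first by rewrite cards0.
    by apply: leq_trans (leq_card_setU _ _) _; apply: leq_add.
  by rewrite cardsU1 cS // -add1n leq_add2r leq_b1.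
exists (fun i => enum_rank_in (rW 0 m_gt0) (r i)).
exists (fun i => (@enum_val _ [in W]) @^-1: S i); split=> [i im|i j w /andP[ij jm]].
  by rewrite (card_preim_enum_val (SW i im)) cS.
have im := ltn_trans ij jm.
rewrite inE /= => wS; rewrite !enum_rankK_in ?rW //; apply: sepS => //.
by rewrite ij.
Qed.

Lemma spread_induced K L (G : graph) (X A : {set 'I_(gn G)}) :
    A \subset X -> K <= #|A| ->
    {in A &, forall u v, u != v -> L < #|[set w in X | gadj u w != gadj v w]|} ->
  spread K L (induced X).
Proof.
move=> sAX leK far; exists ((@enum_val _ [in X]) @^-1: A).
split; first by rewrite (card_preim_enum_val sAX).
move=> i j; rewrite !inE => iA jA ij.
have {}ij : enum_val i != enum_val j by rewrite (inj_eq enum_val_inj).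
apply: leq_trans (far _ _ iA jA ij) _.
rewrite -(@card_preim_enum_val _ X); last by apply/subsetP=> w; rewrite inE => /andP[].
by apply/subset_leq_card/subsetP=> l; rewrite !inE => /andP[].
Qed.

(** Two pigeonholes: each [S i] has more than [L] vertices of one colour, and more than [K] indices
    agree on that colour and on the colour of [r i]. *)
Lemma chain_colored_spread m s K L N (G : graph) (c : 'I_(gn G) -> 'I_N) :
    chain m s G -> N * N * K < m -> N * L < s ->
  exists t : 'I_2 -> 'I_N, spread K L (induced [set v | [exists i, c v == t i]]).
Proof.
case=> r [S [cS sepS]] ltm lts.
have /fin_all_exists[y ybig] (i : 'I_m) :
    exists y, L < #|[set w in S i | c w == y]|.
  have [||y _] := @pigeonhole _ _ (S i) [set: 'I_N] c L; [by move=> w _; rewrite inE | | by exists y].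
  by rewrite cardsT card_ord cS.
have [||[al be] _ big] := @pigeonhole _ _ [set: 'I_m] [set: 'I_N * 'I_N]
    (fun i => (c (r i), y i)) K; [by move=> i _; rewrite inE | |].
  by rewrite !cardsT card_prod !card_ord.
set I := [set i in _ | _] in big.
have IP i : i \in I -> c (r i) = al /\ y i = be by rewrite !inE => /eqP[-> ->].
pose t (i : 'I_2) := if i == ord0 then al else be; exists t.
set X := [set v | _].
have alX v : c v = al -> v \in X by move=> cv; rewrite inE; apply/existsP; exists ord0; rewrite cv.
have beX v : c v = be -> v \in X by move=> cv; rewrite inE; apply/existsP; exists ord_max; rewrite cv.
have sym_diff (i j : 'I_m) : i \in I -> i < j ->
    [set w in S i | c w == y i] \subset [set w in X | gadj (r i) w != gadj (r j) w].
  move=> /IP[_ yi] ij; apply/subsetP=> w; rewrite yi => /setIdP[wS /eqP cw].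
  apply/setIdP; split; first exact: beX.
  by apply: sepS wS; rewrite ij /=.
have far (i j : 'I_m) : i \in I -> j \in I -> i != j ->
    L < #|[set w in X | gadj (r i) w != gadj (r j) w]|.
  move=> iI jI; rewrite neq_ltn => /orP[] ij.
    exact: leq_trans (ybig i) (subset_leq_card (sym_diff i j iI ij)).
  have -> : [set w in X | gadj (r i) w != gadj (r j) w]
          = [set w in X | gadj (r j) w != gadj (r i) w].
    by apply/setP=> w; rewrite !inE eq_sym.
  exact: leq_trans (ybig j) (subset_leq_card (sym_diff j i jI ij)).
apply: (@spread_induced _ _ _ _ [set r i | i : 'I_m in I]).
- by apply/subsetP=> _ /imsetP[i /IP[/alX ? _] ->].
(* Equal vertices have no differences to count, so [far] makes [r] injective on [I]. *)
- rewrite card_in_imset ?(ltnW big) // => i j iI jI rij; apply/eqP/negP=> /negP ij.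
  have := far i j iI jI ij; rewrite rij => /(leq_ltn_trans (leq0n _)) /card_gt0P[w].
  by rewrite inE eqxx andbF.
- move=> _ _ /imsetP[i iI ->] /imsetP[j jI ->] rij; apply: far => //.
  by apply: contraNneq rij => ->.
Qed.

Lemma star_no_spread C : star bdeg_transd C ->
  exists K L, forall G, C G -> ~ spread K L G.
Proof.
case=> herC /(_ 2 isT)[f [f_mono [f_small [D [/bdeg_transd_no_spread[K [L noD]] decC]]]]].
have [n0 f_le] := f_small 6 isT.
(* [Q] serves both pigeonholes. If [m <= N * N * Q], then [m ^ 3 <= N ^ 6 * Q ^ 3 <= (m + m * m) * Q
   ^ 3], which [2 * Q ^ 3 < m] forbids; hence the exponent 6. *)
pose Q := (K + L).+1; pose m := maxn n0 (2 * Q ^ 3).+1.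
have m_gt0 : 0 < m by rewrite /m; lia.
exists (2 ^ m), (2 ^ (2 ^ m) * m) => G CG /spread_chain/(chain_induced m_gt0)[H [HG leH chH]].
have [N [leN [c Dc]]] := decC H (herC _ _ CG HG).
have {}leN : N ^ 6 <= m + m * m.
  apply: (@leq_trans (f (m + m * m) ^ 6)).
    by rewrite leq_exp2r // (leq_trans leN) // f_mono.
  by apply: f_le; rewrite /m; lia.
have NQ : N * N * Q < m.
  rewrite ltnNge; apply/negP=> H1.
  have H3 : m ^ 3 <= (N * N * Q) ^ 3 by rewrite leq_exp2r.
  have H4 : (N * N * Q) ^ 3 = N ^ 6 * Q ^ 3 by rewrite !expnMn -!expnD.
  have H5 : m ^ 3 <= (m + m * m) * Q ^ 3.
    by rewrite (leq_trans H3) // H4 leq_mul2r leN orbT.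
  have H6 : (2 * Q ^ 3) < m by rewrite /m; lia.
  move: H5 H6 m_gt0; rewrite [m ^ 3]expnS [m ^ 2]expnS expn1.
  move: (Q ^ 3) (m) => q n; nia.
have [|| t /noD] := chain_colored_spread (K := K) (L := L) c chH; last by apply; apply: Dc.
- by apply: leq_ltn_trans NQ; rewrite leq_mul2l /Q; apply/orP; right; lia.
- apply: leq_ltn_trans NQ; rewrite /Q; case: (N) => // N'; nia.
Qed.

(** * Flips *)

(** [R] selects the pairs of classes between which adjacency is complemented; [u != v] avoids loops
    when [R] relates a class to itself. *)
Definition flip_degree q d (G : graph) :=
  exists (c : 'I_(gn G) -> 'I_q) (R : rel 'I_q), symmetric R /\
    forall v, #|[set u | (u != v) && (gadj v u (+) R (c v) (c u))]| <= d.

(* Each color class predicts its adjacency to a vertex [w] as the adjacency of its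
   representative to [w]; two mutually disagreeing predictions force one of the
   classes to be small, so trusting the prediction towards the larger class is safe. *)
Lemma no_spread_flip_degree K L :
  exists q d, forall G, ~ spread K L G -> flip_degree q d G.
Proof.
pose Q : finType := ('I_K.+1 * {ffun 'I_K.+1 -> bool})%type.
exists #|Q|, (L + #|Q| * (2 * L)) => G nospread.
pose dst u v := #|[set w : 'I_(gn G) | gadj u w != gadj v w]|.
have dst0 u : dst u u = 0.
  by apply/eqP; rewrite cards_eq0; apply/eqP/setP=> w; rewrite !inE eqxx.
pose P (A : {set 'I_(gn G)}) := [forall u in A, forall v in A, (u != v) ==> (L < dst u v)].
have P0 : P set0 by apply/forall_inP=> u; rewrite inE.
have PP A : P A -> {in A &, forall u v, u != v -> L < dst u v}.
  by move=> /forall_inP PA u v uA vA; move/forall_inP: (PA u uA) => /(_ v vA)/implyP.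
(* A maximal set of pairwise far vertices represents every vertex up to [L] errors, since otherwise
   it could be enlarged. *)
case: (arg_maxnP (fun A : {set 'I_(gn G)} => #|A|) P0) => A PA maxA.
have ltA : #|A| < K.
  by rewrite ltnNge; apply/negP=> leA; apply: nospread; exists A; split=> //; apply: PP.
have /fin_all_exists[rep repP] (v : 'I_(gn G)) : exists u, (u \in A) && (dst u v <= L).
  have [vA|vA] := boolP (v \in A); first by exists v; rewrite vA dst0.
  apply/existsP; apply: contraT; rewrite negb_exists_in => /forall_inP far.
  have dst_sym x y : dst x y = dst y x by apply: eq_card => w; rewrite !inE eq_sym.
  have : P (v |: A).
    apply/forall_inP=> x xA; apply/forall_inP=> y yA; apply/implyP=> xy.
    move: xA yA; rewrite !inE => /predU1P[xv|xA] /predU1P[yv|yA].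
    - by rewrite xv yv eqxx in xy.
    - by rewrite xv dst_sym ltnNge far.
    - by rewrite yv ltnNge far.
    - exact: (PP A PA).
  by move/maxA; rewrite /geq /= cardsU1 vA ltnn.
pose e := enum A.
have idx v : index (rep v) e < K.+1.
  by rewrite ltnS (leq_trans (index_size _ _)) // -cardE ltnW.
pose c v : Q := (Ordinal (idx v), [ffun i : 'I_K.+1 => gadj v (nth v e i)]).
pose pr (x y : Q) := y.2 x.1.
have prE v w : pr (c v) (c w) = gadj (rep v) w.
  by rewrite /pr /= ffunE /= nth_index 1?gsym // mem_enum; have /andP[] := repP v.
have err v : #|[set w | gadj v w != pr (c v) (c w)]| <= L.
  have /andP[_] := repP v; apply: leq_trans; apply/subset_leq_card/subsetP=> w.
  by rewrite !inE prE eq_sym.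
pose cls x := [set v | c v == x].
(* For each pair of vertices from the two classes one of the predictions errs, and each vertex makes
   at most [L] errors. *)
have disagree x y : pr x y != pr y x -> minn #|cls x| #|cls y| <= 2 * L.
  move=> pxy; suff: #|cls x| * #|cls y| <= #|cls x| * L + #|cls y| * L by nia.
  pose E (u w : 'I_(gn G)) : nat := gadj u w != pr (c u) (c w).
  have -> : #|cls x| * #|cls y| = \sum_(u in cls x) \sum_(w in cls y) 1.
    by rewrite -sum_nat_const; apply: eq_bigr => u _; rewrite sum1_card.
  apply: (@leq_trans (\sum_(u in cls x) \sum_(w in cls y) (E u w + E w u))).
    apply: leq_sum => u; rewrite inE => /eqP cu; apply: leq_sum => w.
    rewrite inE => /eqP cw; rewrite /E cu cw [gadj w u]gsym.
    by move: pxy; case: (gadj u w); case: (pr x y); case: (pr y x).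
  have sumE u (B : {set 'I_(gn G)}) : \sum_(w in B) E u w <= L.
    apply: leq_trans (err u); rewrite -sum1_card.
    rewrite [X in _ <= X](eq_bigl (fun w => gadj u w != pr (c u) (c w))); last first.
      by move=> w; rewrite inE.
    rewrite [X in _ <= X]big_mkcond [X in X <= _]big_mkcond /=.
    by apply: leq_sum => w _; rewrite /E; case: (w \in B); case: (_ != _).
  under eq_bigr do rewrite big_split; rewrite big_split /= leq_add //.
    by rewrite -sum_nat_const leq_sum.
  by rewrite exchange_big -sum_nat_const leq_sum.
(* In a tie any symmetric choice works: if the predictions disagree, both classes are small. *)
pose R x y := if #|cls x| < #|cls y| then pr x y else
              if #|cls y| < #|cls x| then pr y x else pr x y && pr y x.
have Rsym x y : R x y = R y x.
  by rewrite /R; case: (ltngtP #|cls x| #|cls y|) => // _; rewrite andbC.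
have Rsmall x y : R x y != pr x y -> #|cls y| <= 2 * L.
  rewrite /R; case: (ltngtP #|cls x| #|cls y|) => [|lt|eq]; first by rewrite eqxx.
    by rewrite eq_sym => /disagree; rewrite (minn_idPr (ltnW lt)).
  have [->|/disagree] := eqVneq (pr x y) (pr y x); first by rewrite andbb eqxx.
  by rewrite eq minnn.
exists (fun v => enum_rank (c v)), (fun i j => R (enum_val i) (enum_val j)).
split=> [i j|v]; first exact: Rsym.
(* The classes where [R] departs from the prediction of [c v]: at most [#|Q|] of them, each with at
   most [2 * L] vertices. *)
pose F := \bigcup_(y | R (c v) y != pr (c v) y) cls y.
apply: (@leq_trans #|[set w | gadj v w != pr (c v) (c w)] :|: F|).
  apply/subset_leq_card/subsetP=> u; rewrite !inE !enum_rankK => /andP[_ vu].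
  have [Rpr|Rpr] := eqVneq (R (c v) (c u)) (pr (c v) (c u)).
    by rewrite -Rpr; move: vu; case: (gadj v u); case: (R _ _).
  by apply/orP; right; apply/bigcupP; exists (c u); rewrite ?inE.
apply: leq_trans (leq_card_setU _ _) (leq_add (err v) _).
apply: (@leq_trans (\sum_(y | R (c v) y != pr (c v) y) 2 * L)).
  rewrite /F; elim/big_rec2: _ => [|y n X Ry le]; first by rewrite cards0.
  by apply: leq_trans (leq_card_setU _ _) (leq_add _ le); apply: Rsmall Ry.
by rewrite sum_nat_const leq_mul2r max_card orbT.
Qed.

(** * Undoing a flip by a transduction *)

Section FlipTransduction.
Variable q : nat.

(** Colour [lshift q i] is meant to mark class [i], and [rshift q i] the vertices whose class is
    related to [i]. The seed of the fold is the constant false. *)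
Definition flip_form x y : form (q + q) :=
  foldr (@FOr _) (FNot (FEq _ 0 0))
    [seq FAnd (FCol (lshift q i) x) (FCol (rshift q i) y) | i <- enum 'I_q].

(* Symmetrised in [0] and [1] so that it is a symmetric formula for every colouring. *)
Definition unflip_form : form (q + q) :=
  let flip := FOr (flip_form 0 1) (flip_form 1 0) in
  FAnd (FNot (FEq _ 0 1))
    (FOr (FAnd (FEdge _ 0 1) (FNot flip)) (FAnd (FNot (FEdge _ 0 1)) flip)).

Lemma sat_flip_form (G : graph) (col : 'I_(gn G) -> 'I_(q + q) -> bool) a x y :
  sat col a (flip_form x y) =
  [exists i, col (a x) (lshift q i) && col (a y) (rshift q i)].
Proof.
transitivity (has (fun i => col (a x) (lshift q i) && col (a y) (rshift q i)) (enum 'I_q)).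
  by rewrite /flip_form; elim: (enum _) => [|i s /= ->] //=; rewrite eqxx.
apply/hasP/existsP => [[i _ ?]|[i ?]]; first by exists i.
by exists i; rewrite ?mem_enum.
Qed.

Lemma sat_unflip_form (G : graph) (col : 'I_(gn G) -> 'I_(q + q) -> bool) u v :
  sat col (asg2 u v) unflip_form = (u != v) && (gadj u v (+)
    ([exists i, col u (lshift q i) && col v (rshift q i)]
     || [exists i, col v (lshift q i) && col u (rshift q i)])).
Proof.
rewrite /= !sat_flip_form /asg2 /=; congr (_ && _).
by set F := [exists i, _] || _; case: (gadj u v); case: F.
Qed.

Lemma flip_form_fv (P : pred nat) x y : P 0 -> P x -> P y -> fv_sub P (flip_form x y).
Proof.
move=> P0 Px Py; rewrite /flip_form; elim: (enum _) => [|i s IH] /=; first by rewrite P0.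
by rewrite Px Py.
Qed.

Lemma unflip_form_fv : fv_sub (fun y => y < 2) unflip_form.
Proof. by rewrite /= !flip_form_fv. Qed.

Lemma unflip_form_sym (G : graph) (col : 'I_(gn G) -> 'I_(q + q) -> bool) u v :
  sat col (asg2 u v) unflip_form = sat col (asg2 v u) unflip_form.
Proof. by rewrite !sat_unflip_form eq_sym gsym orbC. Qed.

Lemma unflip_form_irr (G : graph) (col : 'I_(gn G) -> 'I_(q + q) -> bool) u :
  ~~ sat col (asg2 u u) unflip_form.
Proof. by rewrite sat_unflip_form eqxx. Qed.

Definition unflip_transduction : transduction :=
  @Transduction (q + q) (FEq _ 0 0) unflip_form isT unflip_form_fv
    unflip_form_sym unflip_form_irr.

Section FlipGraph.
Variables (G : graph) (c : 'I_(gn G) -> 'I_q) (R : rel 'I_q).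
Hypothesis Rsym : symmetric R.

Definition flip_adj : rel 'I_(gn G) :=
  fun u v => (v != u) && (gadj u v (+) R (c u) (c v)).

Lemma flip_adj_sym : symmetric flip_adj.
Proof. by move=> u v; rewrite /flip_adj eq_sym gsym Rsym. Qed.

Lemma flip_adj_irr : irreflexive flip_adj.
Proof. by move=> u; rewrite /flip_adj eqxx. Qed.

Definition flip_graph : graph := Graph flip_adj_sym flip_adj_irr.

(** Flipping twice along the same [R] restores [G]; as [R] is symmetric, the two disjuncts of the
    symmetrised formula coincide. *)
Lemma unflip_flip_graph : tapp unflip_transduction flip_graph G.
Proof.
pose col (v : 'I_(gn flip_graph)) (j : 'I_(tk unflip_transduction)) :=
  match split (j : 'I_(q + q)) with inl i => c v == i | inr i => R i (c v) end.
have colE u v : [exists i, col u (lshift q i) && col v (rshift q i)] = R (c u) (c v).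
  have colL i : col u (lshift q i) = (c u == i) by rewrite /col (unsplitK (inl i)).
  have colR i : col v (rshift q i) = R i (c v) by rewrite /col (unsplitK (inr i)).
  apply/existsP/idP => [[i]|Ruv]; first by rewrite colL colR => /andP[/eqP ->].
  by exists (c u); rewrite colL colR eqxx.
have nuT v : v \in nu_set col by rewrite inE /= eqxx.
exists col, (fun v => enum_rank_in (nuT v) v); split.
  exists (fun i => enum_val i) => [v|i]; first by rewrite enum_rankK_in.
  exact: enum_valK_in.
move=> u v; rewrite [RHS]/= !enum_rankK_in // [RHS]sat_unflip_form !colE.
rewrite [R (c v) (c u)]Rsym orbb /= /flip_adj [v == u]eq_sym.
by case: eqVneq => [->|_] /=; [rewrite girr | rewrite addbK].
Qed.

End FlipGraph.
End FlipTransduction.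

(** * Both directions of the decomposition horizon *)

Lemma flip_degree_bdeg_transd (C : gclass) q d :
  hereditary C -> (forall G, C G -> flip_degree q d G) -> bdeg_transd C.
Proof.
move=> herC flipC; split=> //.
exists (fun G => forall v : 'I_(gn G), deg v <= d), d; split=> //.
exists (unflip_transduction q) => G /flipC[c [R [Rsym degR]]].
by exists (flip_graph c Rsym); split; [exact: degR | exact: unflip_flip_graph].
Qed.

Lemma bdeg_transd_hereditary : is_hereditary_property bdeg_transd.
Proof.
split=> [C []//|C D [_ [B [d [degB [T CT]]]]] herD sDC]; split=> //.
by exists B, d; split=> //; exists T => H /sDC/CT.
Qed.

(** Partition into a single part, with [C] itself as the target class. *)
Lemma hereditary_star (P : hprop) C : hereditary C -> P C -> star P C.
Proof.
move=> herC PC; split=> // p p_gt0; exists (fun=> 1); split=> //; split.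
  by move=> k _; exists 1 => n; rewrite exp1n.
exists C; split=> // G CG; exists 1; split=> //; exists (fun=> ord0) => t.
exact: herC CG (induced_embeds _).
Qed.

Theorem mainTheorem4 :
  is_hereditary_property bdeg_transd /\ decomposition_horizon bdeg_transd.
Proof.
split=> [|C]; first exact: bdeg_transd_hereditary.
split=> [starC|bC]; last exact: hereditary_star bC.1 bC.
have [K [L noC]] := star_no_spread starC.
have [q [d flipC]] := no_spread_flip_degree K L.
by apply: (flip_degree_bdeg_transd starC.1) => G /noC; apply: flipC.
Qed.
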